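(* Let $a_1\le a_2\le\cdots\le a_n$ be positive integers which alternate between even and odd, or at least one of which is odd. Let $X=\mathbf{P}^{a_1}\times\cdots\times\mathbf{P}^{a_n}$ over $\mathbb{C}$, with the ample line bundle $\mathscr{L}=\mathcal{O}_X(1,\ldots,1)$, and put $N=h^0(X,\mathcal{O}_X(1,\ldots,1))-1$. Let $\alpha,\beta,\gamma$ be positive integers. Then there exists a linear monad on $X$ of the form $$0\longrightarrow\mathcal{O}_X(-1,\ldots,-1)^{\oplus\alpha}\xrightarrow{\ \overline{A}\ }\mathcal{O}_X^{\oplus\beta}\xrightarrow{\ \overline{B}\ }\mathcal{O}_X(1,\ldots,1)^{\oplus\gamma}\longrightarrow 0$$ if at least one of the following is satisfied: (a) $\beta\ge 2\gamma+N-1$ and $\beta\ge\alpha+\gamma$; (b) $\beta\ge\alpha+\gamma+N$.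
   Context: For integers $d_1,\ldots,d_n$, $\mathcal{O}_X(d_1,\ldots,d_n)$ denotes the tensor product of the pullbacks to $X$, under the projections onto the factors, of $\mathcal{O}_{\mathbf{P}^{a_1}}(d_1),\ldots,\mathcal{O}_{\mathbf{P}^{a_n}}(d_n)$. A monad on a nonsingular projective variety $X$ is a complex of vector bundles $0\to M_0\xrightarrow{\alpha}M_1\xrightarrow{\beta}M_2\to 0$ (so $\beta\circ\alpha=0$) which is exact at $M_0$ and at $M_2$, i.e. the first map is injective and the second is surjective. ''Linear'' refers to the displayed shape: the maps are matrices whose entries are sections of $\mathcal{O}_X(1,\ldots,1)$ (equivalently, restrictions of linear forms under the Segre embedding $X\hookrightarrow\mathbf{P}^N$). *)

(* Defs.v *)
From HB Require Import structures.
From mathcomp Require Import all_boot all_order all_algebra.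
From mathcomp Require Import complex mpoly.
From mathcomp Require Import classical_sets reals.

Set Implicit Arguments.
Unset Strict Implicit.
Unset Printing Implicit Defensive.
Import Order.TTheory GRing.Theory Num.Theory.
Local Open Scope ring_scope.
Local Open Scope classical_set_scope.

(* The variety X = P^(a_1) x ... x P^(a_n) over an algebraically closed field
   K, and its line bundles O_X(d_1, ..., d_n), in classical language.

   A point of X is given by a system of homogeneous coordinates, one nonzero
   row vector for each factor.  A Zariski open subset of X is handled through
   the set of all homogeneous coordinates of its points; these sets are
   automatically stable under independent rescaling of the factors, being cut
   out by multihomogeneous polynomials.  Likewise a section of O_X(d) over an
   open set U is handled as a function of the homogeneous coordinates of the
   points of U that is locally a quotient of two multihomogeneous polynomials,
   of multidegrees differing by d.  Its values outside U are irrelevant. *)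
Section ProductOfProjectiveSpaces.
Variables (K : closedFieldType) (n : nat) (a : 'I_n -> nat).

Record hcoord := HCoord {
  hcoord_val :> forall i, 'rV[K]_(a i).+1;
  hcoord_neq0 : forall i, hcoord_val i != 0 }.

(* The polynomial ring of X has one variable for each pair (i, j), where
   j <= a_i; enum_val numbers these pairs. *)
Definition hvar : finType := {i : 'I_n & 'I_(a i).+1}.
Definition hpoly := {mpoly K[#|hvar|]}.

Definition heval (p : hpoly) (x : hcoord) : K :=
  p.@[fun k => x (tag (enum_val k)) 0 (tagged (enum_val k))].

Definition multihomog (D : 'I_n -> nat) (p : hpoly) :=
  forall m, m \in msupp p ->
  forall i, (\sum_(k < #|hvar| | tag (enum_val k) == i) m k)%N = D i.

Definition zopen (U : set hcoord) :=
  exists T : set hpoly,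
    (forall p, T p -> exists D, multihomog D p) /\
    (forall x, U x <-> exists2 p, T p & heval p x != 0).

Definition is_section (d : 'I_n -> int) (U : set hcoord) (s : hcoord -> K) :=
  forall x, U x -> exists V : set hcoord,
    [/\ zopen V, V x, V `<=` U &
        exists (P Q : hpoly) (D E : 'I_n -> nat),
        [/\ multihomog D P, multihomog E Q,
            forall i, (D i)%:Z = (E i)%:Z + d i &
            forall y, V y -> heval Q y != 0 /\ s y = heval P y / heval Q y]].

(* Sections over U of the direct sum of m copies of O_X(d). *)
Definition is_vsection (d : 'I_n -> int) m (U : set hcoord)
    (s : hcoord -> 'cV[K]_m) :=
  forall k, is_section d U (fun x => s x k 0).

Definition diag_twist (k : int) : 'I_n -> int := fun=> k.

(* h^0(X, O_X(d)) = m: the K-vector space of global sections of O_X(d) has a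
   basis with m elements. *)
Definition h0_eq (d : 'I_n -> int) (m : nat) :=
  exists e : hcoord -> 'cV[K]_m,
    is_vsection d [set: hcoord] e /\
    (forall s, is_section d [set: hcoord] s ->
       exists! c : 'rV[K]_m, forall x, s x = (c *m e x) 0 0).

(* A p x q matrix with entries in H^0(X, O_X(1, ..., 1)).  It defines, for each
   k, a map of sheaves O_X(k, ..., k)^q -> O_X(k+1, ..., k+1)^p which sends a
   section s over U to x |-> M x *m s x, see linear_mxP below. *)
Definition linear_mx p q (M : hcoord -> 'M[K]_(p, q)) :=
  forall i j, is_section (diag_twist 1) [set: hcoord] (fun x => M x i j).

Definition sheaf_injective (k : int) p q (M : hcoord -> 'M[K]_(p, q)) :=
  forall U (s : hcoord -> 'cV[K]_q),
    zopen U -> is_vsection (diag_twist k) U s ->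
    (forall x, U x -> M x *m s x = 0) -> forall x, U x -> s x = 0.

Definition sheaf_surjective (k : int) p q (M : hcoord -> 'M[K]_(p, q)) :=
  forall U (t : hcoord -> 'cV[K]_p),
    zopen U -> is_vsection (diag_twist (k + 1)) U t ->
    forall x, U x -> exists V : set hcoord,
      [/\ zopen V, V x, V `<=` U &
          exists2 s : hcoord -> 'cV[K]_q, is_vsection (diag_twist k) V s &
            forall y, V y -> M y *m s y = t y].

Definition sheaf_comp0 (k : int) p q r (N : hcoord -> 'M[K]_(p, q))
    (M : hcoord -> 'M[K]_(q, r)) :=
  forall U (s : hcoord -> 'cV[K]_r),
    zopen U -> is_vsection (diag_twist k) U s ->
    forall x, U x -> N x *m (M x *m s x) = 0.

(* A and B are the maps of a linear monad
   0 -> O_X(-1, ..., -1)^al -> O_X^be -> O_X(1, ..., 1)^ga -> 0. *)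
Definition linear_monad al be ga (A : hcoord -> 'M[K]_(be, al))
    (B : hcoord -> 'M[K]_(ga, be)) :=
  [/\ linear_mx A, linear_mx B, sheaf_comp0 (-1) B A,
      sheaf_injective (-1) A & sheaf_surjective 0 B].

Lemma multihomogM D E p q :
  multihomog D p -> multihomog E q -> multihomog (fun i => D i + E i)%N (p * q).
Proof.
move=> hp hq m /msuppM_le /allpairsP[[m1 m2] /= [/hp h1 /hq h2 ->]] i.
rewrite -(h1 i) -(h2 i) -big_split /=.
by apply: eq_bigr => k _; rewrite mnmDE.
Qed.

Lemma multihomogD D p q :
  multihomog D p -> multihomog D q -> multihomog D (p + q).
Proof.
by move=> hp hq m /msuppD_le; rewrite mem_cat => /orP[/hp|/hq].
Qed.

Lemma zopenT : zopen [set: hcoord].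
Proof.
exists [set 1]; split=> [p ->|x].
  exists (fun=> 0%N) => m; rewrite msupp1 inE => /eqP -> i.
  by rewrite big1 // => k _; rewrite mnm0E.
by split=> // _; exists 1; rewrite // /heval rmorph1 oner_neq0.
Qed.

Lemma zopenI U V : zopen U -> zopen V -> zopen (U `&` V).
Proof.
move=> [S [hS SU]] [T [hT TV]].
exists [set r | exists p q, [/\ S p, T q & r = p * q]]; split.
  move=> _ [p [q [/hS[D hp] /hT[E hq] ->]]].
  by exists (fun i => D i + E i)%N; apply: multihomogM.
move=> x; split=> [[/SU[p Sp px] /TV[q Tq qx]]|[_ [p [q [Sp Tq ->]]]]].
  by exists (p * q); [exists p, q | rewrite /heval rmorphM mulf_neq0].
rewrite /heval rmorphM mulf_eq0 negb_or => /andP[px qx].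
by split; [apply/SU; exists p | apply/TV; exists q].
Qed.

Lemma is_sectionM d e U s t : is_section d U s -> is_section e U t ->
  is_section (fun i => d i + e i) U (fun x => s x * t x).
Proof.
move=> hs ht x Ux.
have [V [oV Vx VU [P [Q [D [E [hP hQ DE sE]]]]]]] := hs x Ux.
have [W [oW Wx WU [P' [Q' [D' [E' [hP' hQ' DE' tE]]]]]]] := ht x Ux.
exists (V `&` W); split=> //; first exact: zopenI.
  by move=> y [/VU].
exists (P * P'), (Q * Q'), (fun i => D i + D' i)%N, (fun i => E i + E' i)%N.
split; [exact: multihomogM | exact: multihomogM | |].
  by move=> i; rewrite !PoszD DE DE' addrACA.
move=> y [/sE[Qy sy] /tE[Q'y ty]].
by rewrite sy ty /heval !rmorphM mulf_neq0 // mulf_div.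
Qed.

Lemma is_sectionD d U s t : is_section d U s -> is_section d U t ->
  is_section d U (fun x => s x + t x).
Proof.
move=> hs ht x Ux.
have [V [oV Vx VU [P [Q [D [E [hP hQ DE sE]]]]]]] := hs x Ux.
have [W [oW Wx WU [P' [Q' [D' [E' [hP' hQ' DE' tE]]]]]]] := ht x Ux.
exists (V `&` W); split=> //; first exact: zopenI.
  by move=> y [/VU].
exists (P * Q' + P' * Q), (Q * Q').
exists (fun i => D i + E' i)%N, (fun i => E i + E' i)%N.
split; [| exact: multihomogM | |].
- apply: multihomogD; first exact: multihomogM.
  move=> m /(multihomogM hP' hQ) + i => ->.
  have : (D' i + E i)%:Z = (D i + E' i)%:Z by rewrite !PoszD DE DE' [LHS]addrAC [RHS]addrAC [(E i)%:Z + _]addrC.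
  by case.
- by move=> i; rewrite !PoszD DE addrAC.
move=> y [/sE[Qy sy] /tE[Q'y ty]].
by rewrite sy ty /heval rmorphD !rmorphM mulf_neq0 // addf_div.
Qed.

Lemma is_section0 d U : zopen U -> is_section d U (fun=> 0).
Proof.
move=> oU x Ux.
have /fin_all_exists[j xj] : forall i, exists j, x i 0 j != 0.
  by move=> i; apply/existsP; have := hcoord_neq0 x i; apply: contraR =>
    /existsPn h; apply/eqP/rowP => j; rewrite mxE; have := h j; rewrite negbK => /eqP.
pose v i : 'I_#|hvar| := enum_rank (Tagged (fun i => 'I_(a i).+1) (j i)).
pose Q : hpoly := 'X_[[multinom if k == v (tag (enum_val k))
  then `|d (tag (enum_val k))|%N else 0%N | k < #|hvar|]].
have hQ : multihomog (fun i => `|d i|%N) Q.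
  move=> m; rewrite msuppX inE => /eqP -> i.
  rewrite (bigD1 (v i)) /= ?enum_rankK // mnmE enum_rankK eqxx.
  by rewrite big1 ?addn0 // => k /andP[/eqP ki /negPf ne]; rewrite mnmE ki ne.
have Qx : heval Q x != 0.
  rewrite /heval mevalX; apply/prodf_neq0 => k _; rewrite mnmE.
  have [kv|_] := eqVneq k (v (tag (enum_val k))); last by rewrite expr0 oner_neq0.
  by rewrite expf_neq0 // kv /v enum_rankK.
have oV : zopen (U `&` [set y | heval Q y != 0]).
  apply: zopenI => //; exists [set Q]; split=> [p ->|y].
    by exists (fun i => `|d i|%N).
  by split=> [Qy|[p ->]//]; exists Q.
exists (U `&` [set y | heval Q y != 0]); split=> //.
exists 0, Q, (fun i => absz ((absz (d i))%:Z + d i)), (fun i => `|d i|%N); split=> //.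
- by move=> m; rewrite msupp0.
- by move=> i; rewrite gez0_abs // abszE -lerBlDr sub0r -normrN ler_norm.
by move=> y [_ Qy]; rewrite {2}/heval rmorph0 mul0r.
Qed.

Lemma linear_mxP k p q (M : hcoord -> 'M[K]_(p, q)) U s :
  linear_mx M -> zopen U -> is_vsection (diag_twist k) U s ->
  is_vsection (diag_twist (k + 1)) U (fun x => M x *m s x).
Proof.
move=> hM oU hs i.
rewrite (_ : (fun x => _) = fun x => \sum_j M x i j * s x j 0); last first.
  by apply: boolp.funext => x; rewrite mxE.
elim: (index_enum _) => [|j r IH].
  rewrite (_ : (fun x => _) = fun=> 0); first exact: is_section0.
  by apply: boolp.funext => x; rewrite big_nil.
rewrite (_ : (fun x => _) =
  fun x => M x i j * s x j 0 + \sum_(j <- r) M x i j * s x j 0); last first.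
  by apply: boolp.funext => x; rewrite big_cons.
apply: is_sectionD IH.
rewrite (_ : diag_twist _ = fun i => diag_twist 1 i + diag_twist k i); last first.
  by apply: boolp.funext => ?; rewrite /diag_twist addrC.
apply: is_sectionM (hs j) => x Ux.
have [V [oV Vx _ [P [Q [D [E [hP hQ DE sE]]]]]]] := hM i j x I.
exists (V `&` U); split=> //; first exact: zopenI.
by exists P, Q, D, E; split=> // y [/sE].
Qed.

End ProductOfProjectiveSpaces.

(* Main.v *)
Require Import Defs.
From HB Require Import structures.
From mathcomp Require Import all_boot all_order all_algebra perm.
From mathcomp Require Import complex mpoly.
From mathcomp Require Import classical_sets reals.
From mathcomp Require Import zify.
Set Implicit Arguments.
Unset Strict Implicit.
Unset Printing Implicit Defensive.
Import Order.TTheory GRing.Theory Num.Theory.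

(* Let e_0, ..., e_N be a basis of the sections of O(1, ..., 1); they have no
   common zero.  A banded Toeplitz matrix T(v) whose rows are the shifts of v
   has independent rows as soon as v is nonzero.

   In case (a), let y be one of the e_k, let v consist of the N others, and put
   B = [T(v) | y I].  At each point y or v is nonzero, so B is surjective.  The
   columns of [y I; -T(v)] are linear syzygies of B which are independent
   wherever y is nonzero, hence give an injective map of sheaves.  There are
   beta - gamma >= alpha of them, and alpha of these form A.

   In case (b), take B = [T(e) | 0] and A = [0; y I]. *)

Section MonadConstruction.
Local Open Scope ring_scope.

(** * Nonvanishing of a nonzero polynomial at a point with nonzero coordinates *)

(** Base [b] digits are unique: the remainder mod [b] is the lowest digit, the quotient carries the
    others. *)
Lemma radix_inj (b n : nat) (c d : 'I_n -> nat) :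
  (forall i, c i < b)%N -> (forall i, d i < b)%N ->
  (\sum_i c i * b ^ i = \sum_i d i * b ^ i)%N -> c =1 d.
Proof.
elim: n c d => [|n IH] c d cb db; first by move=> _ [].
have shift (f : 'I_n.+1 -> nat) :
    (\sum_i f i * b ^ i = (\sum_(i < n) f (lift ord0 i) * b ^ i) * b + f ord0)%N.
  rewrite big_ord_recl /= expn0 muln1 addnC; congr (_ + _)%N.
  by rewrite big_distrl /=; apply: eq_bigr => i _; rewrite expnSr mulnA.
have b_gt0 : (0 < b)%N by apply: leq_ltn_trans (cb ord0).
rewrite !shift => E.
have E0 : c ord0 = d ord0.
  by have := congr1 (modn^~ b) E; rewrite !modnMDl !modn_small.
have /IH E1 : (\sum_(i < n) c (lift ord0 i) * b ^ i =
               \sum_(i < n) d (lift ord0 i) * b ^ i)%N.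
  by move/eqP: E; rewrite E0 eqn_add2r eqn_pmul2r // => /eqP.
move=> i; case: (unliftP ord0 i) => [j|] -> //.
exact: E1.
Qed.

(* Kronecker substitution: the values x_i = t^(b^i), with b larger than all
   exponents of q, turn q into a nonzero polynomial in t. *)
Lemma mpoly_neq0_eval (K : closedFieldType) n (q : {mpoly K[n]}) :
  q != 0 -> exists v : 'I_n -> K, (forall i, v i != 0) /\ q.@[v] != 0.
Proof.
move=> q0; pose b := msize q.
pose code (m : 'X_{1..n}) := (\sum_i m i * b ^ i)%N.
pose P : {poly K} := \sum_(m <- msupp q) q@_m *: 'X^(code m).
have ltb m i : m \in msupp q -> (m i < b)%N.
  move=> /msize_mdeg_lt; apply: leq_ltn_trans.
  by rewrite mdegE (bigD1 i) //= leq_addr.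
have code_inj m m' : m \in msupp q -> m' \in msupp q ->
    code m = code m' -> m = m'.
  move=> hm hm' /radix_inj E; apply/mnmP => i; apply: E => j; exact: ltb.
have P0 : P != 0.
  have m_in := mlead_supp q0.
  apply/eqP => /(congr1 (fun p : {poly K} => p`_(code (mlead q)))).
  rewrite coef0 coef_sum (bigD1_seq (mlead q)) ?msupp_uniq //=.
  rewrite coefZ coefXn eqxx mulr1 big_seq_cond big1 ?addr0.
    by move/eqP; rewrite -/(mleadc q) mleadc_eq0 (negPf q0).
  move=> m /andP[hm ne]; rewrite coefZ coefXn; case: eqP => [E|]; last by rewrite mulr0.
  by rewrite (code_inj _ _ m_in hm E) eqxx in ne.
(* The factor ['X] forces the non-root [t], and so every [t ^+ (b ^ i)], to be nonzero. *)
have /closed_nonrootP[t] : P * 'X != 0 by rewrite mulf_neq0 ?polyX_eq0.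
rewrite rootM negb_or rootX => /andP[Pt t0].
exists (fun i => t ^+ (b ^ i)); split=> [i|]; first exact: expf_neq0.
suff -> : q.@[fun i : 'I_n => t ^+ (b ^ i)] = P.[t] by [].
rewrite mevalE horner_sum; apply: eq_bigr => m _.
rewrite hornerZ hornerXn /code -prodrXr; congr (_ * _).
by apply: eq_bigr => i _; rewrite mulnC exprM.
Qed.

(** * Algebra of sections of line bundles on X *)

Section Sections.
Variables (K : closedFieldType) (n : nat) (a : 'I_n -> nat).
Local Notation hcoord := (hcoord K a).
Local Notation hpoly := (hpoly K a).
Local Open Scope classical_set_scope.
Implicit Types (p q : hpoly) (U V : set hcoord) (d : 'I_n -> int).

Lemma hevalM p q x : heval (p * q) x = heval p x * heval q x.
Proof. exact: mevalM. Qed.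

(** A vector with no zero entry has a nonzero block for each factor, so it is a system of
    homogeneous coordinates. *)
Lemma heval_eq0 p : (forall x, heval p x = 0) -> p = 0.
Proof.
move=> h; apply/eqP; apply: contraT => /mpoly_neq0_eval[v [v0]].
pose w i : 'rV[K]_(a i).+1 := \row_j v (enum_rank (Tagged (fun i => 'I_(a i).+1) j)).
have w0 i : w i != 0.
  by apply/eqP => /rowP/(_ 0); rewrite !mxE => /eqP; rewrite (negPf (v0 _)).
suff -> : p.@[v] = heval p (HCoord w0) by rewrite h eqxx.
apply: meval_eq => k; rewrite /= mxE; congr v.
by apply: (canRL enum_valK); case: (enum_val k).
Qed.

Lemma multihomogC (c : K) : @multihomog K n a (fun=> 0%N) c%:MP.
Proof.
move=> m; rewrite msuppC; case: eqP => // _; rewrite inE => /eqP -> i.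
by rewrite big1 // => k _; rewrite mnm0E.
Qed.

Lemma hevalC (c : K) x : heval (c%:MP : hpoly) x = c.
Proof. exact: mevalC. Qed.

Lemma heval1 x : heval (1 : hpoly) x = 1.
Proof. exact: meval1. Qed.

Lemma zopen_neq0 D p : multihomog D p -> zopen [set x | heval p x != 0].
Proof.
move=> hp; exists [set p]; split=> [_ ->|x]; first by exists D.
by split=> [px|[_ ->]]; first by exists p.
Qed.

Lemma zopenP U x : zopen U -> U x ->
  exists2 p, heval p x != 0 & forall y, heval p y != 0 -> U y.
Proof.
by move=> [T [_ UT]] /UT[p Tp px]; exists p => // y py; apply/UT; exists p.
Qed.

Lemma is_section_restrict d U V s :
  zopen V -> V `<=` U -> is_section d U s -> is_section d V s.
Proof.
move=> oV VU hs x Vx.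
have [W [oW Wx WU [P [Q [D [E [hP hQ DE sE]]]]]]] := hs x (VU _ Vx).
exists (W `&` V); split=> //; first exact: zopenI.
by exists P, Q, D, E; split=> // y [/sE].
Qed.

Lemma is_section_cst U c : zopen U -> is_section (diag_twist 0) U (fun=> c).
Proof.
move=> oU x Ux; exists U; split=> //.
exists c%:MP, 1, (fun=> 0%N), (fun=> 0%N).
by split; [exact: multihomogC..| | move=> y _; rewrite heval1 hevalC divr1 oner_neq0].
Qed.

Lemma eq_is_section d d' U s s' :
  d =1 d' -> s =1 s' -> is_section d U s -> is_section d' U s'.
Proof. by move=> /boolp.funext -> /boolp.funext ->. Qed.

Lemma is_sectionZ d U c s :
  zopen U -> is_section d U s -> is_section d U (fun x => c * s x).
Proof.
move=> oU hs; apply: eq_is_section (is_sectionM (is_section_cst c oU) hs) => // i.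
exact: add0r.
Qed.

Lemma is_section_sum (I : Type) (r : seq I) d U (F : I -> hcoord -> K) :
  zopen U -> (forall i, is_section d U (F i)) ->
  is_section d U (fun x => \sum_(i <- r) F i x).
Proof.
move=> oU hF; elim: r => [|i r IH].
  by apply: eq_is_section (is_section0 d oU) => // x; rewrite big_nil.
by apply: eq_is_section (is_sectionD (hF i) IH) => // x; rewrite big_cons.
Qed.

Lemma is_section_prod (m : nat) k U (F : 'I_m -> hcoord -> K) :
  zopen U -> (forall i, is_section (diag_twist k) U (F i)) ->
  is_section (diag_twist (m%:Z * k)) U (fun x => \prod_i F i x).
Proof.
move=> oU; elim: m F => [|m IH] F hF.
  apply: eq_is_section (is_section_cst 1 oU) => [i|x]; last by rewrite big_ord0.
  by rewrite /diag_twist mul0r.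
apply: eq_is_section (is_sectionM (hF ord0) (IH _ (fun i => hF (lift ord0 i)))).
  by move=> i; rewrite /diag_twist intS mulrDl mul1r.
by move=> x; rewrite big_ord_recl.
Qed.

(** Each term of the Leibniz expansion is a constant times a product of [m] sections of O(1, ...,
    1). *)
Lemma is_section_det m U (M : hcoord -> 'M[K]_m) : zopen U ->
  (forall i j, is_section (diag_twist 1) U (fun x => M x i j)) ->
  is_section (diag_twist m%:Z) U (fun x => \det (M x)).
Proof.
move=> oU hM; apply: is_section_sum => // s; apply: is_sectionZ => //.
have := is_section_prod (F := fun i x => M x i (s i)) oU (fun i => hM i (s i)).
by apply: eq_is_section => // i; rewrite /diag_twist mulr1.
Qed.

Lemma is_section_div d d' U s t :
  is_section d U s -> is_section d' U t -> (forall x, U x -> t x != 0) ->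
  is_section (fun i => d i - d' i) U (fun x => s x / t x).
Proof.
move=> hs ht t0 x Ux.
have [V [oV Vx VU [P [Q [D [E [hP hQ DE sE]]]]]]] := hs x Ux.
have [W [oW Wx WU [P' [Q' [D' [E' [hP' hQ' DE' tE]]]]]]] := ht x Ux.
exists (V `&` W); split=> //; [exact: zopenI | by move=> y [/VU] |].
exists (P * Q'), (Q * P'), (fun i => D i + E' i)%N, (fun i => E i + D' i)%N.
split; [exact: multihomogM | exact: multihomogM | |].
  move=> i; rewrite !PoszD DE DE' -!addrA; congr (_ + _).
  by rewrite [d' i + _]addrC subrK addrC.
move=> y [Vy /tE[Q'y ty]]; have [Qy sy] := sE y Vy.
have := t0 y (VU _ Vy); rewrite ty mulf_eq0 negb_or => /andP[P'y _].
by rewrite !hevalM mulf_neq0 // sy invf_div mulf_div.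
Qed.

Lemma zopen_section_neq0 d U s x : is_section d U s -> U x -> s x != 0 ->
  exists V, [/\ zopen V, V x, V `<=` U & forall y, V y -> s y != 0].
Proof.
move=> hs Ux; have [V [oV Vx VU [P [Q [D [E [hP _ _ sE]]]]]]] := hs x Ux.
have [Qx ->] := sE x Vx.
rewrite mulf_eq0 negb_or => /andP[Px _].
exists (V `&` [set y | heval P y != 0]); split=> //.
- by apply: zopenI => //; exact: zopen_neq0 hP.
- by move=> y [/VU].
by move=> y [/sE[Qy ->] /= Py]; rewrite mulf_neq0 ?invr_neq0.
Qed.

(* X is irreducible: the nonvanishing loci of s and of y would meet. *)
Lemma is_section_mul_eq0 d d' U s y (p : hcoord) :
  zopen U -> is_section d U s -> is_section d' [set: hcoord] y -> y p != 0 ->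
  (forall x, U x -> y x * s x = 0) -> forall x, U x -> s x = 0.
Proof.
move=> oU hs hy yp ys x Ux.
have [V [oV Vx VU [P [Q [_ [_ [_ _ _ sE]]]]]]] := hs x Ux.
have [W [oW Wp _ [P' [Q' [_ [_ [_ _ _ yE]]]]]]] := hy p I.
have [v vx vV] := zopenP oV Vx; have [w wp wW] := zopenP oW Wp.
have [_ sx] := sE x Vx; have [_ yp'] := yE p Wp.
have neq0 q z : heval q z != 0 -> q != 0.
  by apply: contraNneq => ->; rewrite /heval meval0.
have P'0 : P' != 0.
  by apply: (neq0 _ p); apply: contraNneq yp; rewrite yp' => ->; rewrite mul0r.
(* Off the zeros of [v] and [w] both quotients are valid, and there [y * s = 0] reads [P' * P = 0].
   The polynomial ring is a domain, which leaves [P = 0]. *)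
have /eqP : v * w * P' * P = 0.
  apply: heval_eq0 => z; rewrite !hevalM; apply/eqP.
  rewrite -!mulrA mulf_eq0; have [//|/vV Vz] := eqVneq (heval v z) 0.
  rewrite /= mulf_eq0; have [//|/wW Wz /=] := eqVneq (heval w z) 0.
  have /eqP := ys z (VU _ Vz); have [Qz ->] := sE z Vz; have [Q'z ->] := yE z Wz.
  by rewrite !mulf_eq0 !invr_eq0 (negPf Qz) (negPf Q'z) !orbF.
rewrite !mulf_eq0 (negPf (neq0 _ _ vx)) (negPf (neq0 _ _ wp)) (negPf P'0) /=.
by move=> /eqP P0; rewrite sx P0 /heval meval0 mul0r.
Qed.

End Sections.

(** * Ranks of banded Toeplitz matrices *)

(** The guard [i <= j] is needed because truncated subtraction would put [v_0] below the diagonal;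
    [insub] gives 0 to the right of the band. *)
Definition toeplitz (K : fieldType) m p q (v : 'cV[K]_m) : 'M[K]_(p, q) :=
  \matrix_(i, j) if (i <= j)%N then oapp (v^~ 0) 0 (insub (j - i)%N) else 0.

(* If v_k is the first nonzero entry of v, the columns k, ..., k + p - 1 form
   an upper triangular matrix with v_k on the diagonal. *)
Lemma toeplitz_row_free (K : fieldType) m p q (v : 'cV[K]_m) :
  v != 0 -> (m + p <= q.+1)%N -> row_free (toeplitz p q v).
Proof.
move=> v0 mpq; apply: inj_row_free => u uT0.
have [k vk kmin] : exists2 k : 'I_m, v k 0 != 0 & forall l : 'I_m, (l < k)%N -> v l 0 = 0.
  have /cV0Pn[k0 vk0] := v0.
  case: (arg_minnP (P := fun k => v k 0 != 0) val vk0) => k vk kmin.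
  exists k => // l lk; apply/eqP; apply: contraTT lk => /kmin.
  by rewrite -leqNgt.
(* The entries of [u] are killed in increasing order, column [k + i] giving [u_i = 0]. *)
suff u0 r (i : 'I_p) : (i < r)%N -> u 0 i = 0.
  by apply/rowP => i; rewrite mxE (u0 i.+1).
elim: r i => [//|r IH] i; rewrite ltnS leq_eqVlt => /orP[/eqP ir|]; last exact: IH.
(* Since [k <= m - 1] and [i <= p - 1], the bound [m + p <= q + 1] is just enough. *)
have jq : (k + i < q)%N.
  have := ltn_ord k; have := ltn_ord i; lia.
have /rowP/(_ (Ordinal jq)) := uT0.
rewrite !mxE (bigD1 i) //= mxE /= leq_addl addnK valK /= big1 ?addr0 => [/eqP|l li].
  by rewrite mulf_eq0 (negPf vk) orbF => /eqP.
(* Rows above [i] drop out by induction; rows below meet column [k + i] in an entry of [v] of index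
   less than [k], or outside the band. *)
have [lti|] := ltnP l i; first by rewrite IH ?mul0r // -ir.
rewrite leq_eqVlt eq_sym => /orP[/eqP/val_inj il|il]; first by rewrite il eqxx in li.
rewrite mxE /=; case: ifP => lki; last by rewrite mulr0.
case: insubP => [j _ jE|] /=; last by rewrite mulr0.
by rewrite kmin ?mulr0 // jE; lia.
Qed.

Lemma row_free_row_mxl (K : fieldType) m n1 n2
    (A : 'M[K]_(m, n1)) (B : 'M_(m, n2)) :
  row_free A -> row_free (row_mx A B).
Proof.
move=> /row_freeP[C AC]; apply/row_freeP; exists (col_mx C 0).
by rewrite mul_row_col mulmx0 addr0.
Qed.

Lemma row_free_row_mxr (K : fieldType) m n1 n2
    (A : 'M[K]_(m, n1)) (B : 'M_(m, n2)) :
  row_free B -> row_free (row_mx A B).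
Proof.
move=> /row_freeP[C BC]; apply/row_freeP; exists (col_mx 0 C).
by rewrite mul_row_col mulmx0 add0r.
Qed.

(** * From pointwise conditions on matrices to maps of sheaves *)

Section LinearMonads.
Variables (K : closedFieldType) (n : nat) (a : 'I_n -> nat).
Local Notation hcoord := (hcoord K a).
Local Open Scope classical_set_scope.

(** A maximal minor that is nonzero at [x] stays nonzero nearby, and Cramer's rule then gives a
    local preimage with regular entries. *)
Lemma linear_mx_surjective p q (M : hcoord -> 'M[K]_(p, q)) :
  linear_mx M -> (forall x, row_free (M x)) -> sheaf_surjective 0 M.
Proof.
move=> hM Mfree U t oU ht x Ux.
have MTfull : row_full (M x)^T by rewrite /row_full mxrank_tr; apply: Mfree.
(* [g] selects [p] columns that form an invertible block at [x]. *)
pose g := fullrankfun MTfull; pose T y := colsub g (M y).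
have Tx : \det (T x) != 0.
  have := fullrowsub_unit MTfull.
  by rewrite unitmxE unitfE -det_tr trmx_mxsub trmxK.
have hT i j : is_section (diag_twist 1) [set: hcoord] (fun y => T y i j).
  by apply: eq_is_section (hM i (g j)) => // y; rewrite !mxE.
have oT := @zopenT K n a.
have hdet := is_section_det oT hT.
have [V [oV Vx _ Tneq0]] := zopen_section_neq0 hdet I Tx.
have hadj i j : is_section (diag_twist p.-1) [set: hcoord] (fun y => \adj (T y) i j).
  pose S y := row' j (col' i (T y)).
  have hS : is_section (diag_twist p.-1) [set: hcoord] (fun y => \det (S y)).
    apply: is_section_det => // i' j'.
    by apply: eq_is_section (hT (lift j i') (lift i j')) => // y; rewrite !mxE.
  apply: eq_is_section (is_sectionZ ((-1) ^+ (j + i)) oT hS) => // y.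
  by rewrite mxE.
pose W := U `&` V; have oW : zopen W by apply: zopenI.
pose r y : 'cV[K]_p := (\det (T y))^-1 *: (\adj (T y) *m t y).
exists W; split=> //; first by move=> y [].
(* [colsub g 1%:M] extends [r y] by zero to the columns that were not selected. *)
exists (fun y => colsub g 1%:M *m r y) => [j|y [Uy Vy]]; last first.
  rewrite mulmxA mulmx_colsub mulmx1 -scalemxAr mulmxA mul_mx_adj mul_scalar_mx.
  by rewrite scalerA mulVf ?scale1r //; apply: Tneq0.
have hr i : is_section (diag_twist 0) W (fun y => r y i 0).
  have hsum : is_section (diag_twist p) W (fun y => \sum_j \adj (T y) i j * t y j 0).
    apply: is_section_sum => // j'.
    have hadjW := is_section_restrict oW (@subsetT _ _) (hadj i j').
    have htW := is_section_restrict oW (@subIsetl _ _ _) (ht j').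
    apply: eq_is_section (is_sectionM hadjW htW) => // k.
    (* Cofactors have degree [p.-1] and [t] has degree 1; the index [i] shows [p > 0], so the sum is
       [p]. *)
    by rewrite /diag_twist add0r -PoszD addn1 prednK // (leq_trans _ (ltn_ord i)).
  have hdetW := is_section_restrict oW (@subsetT _ _) hdet.
  have nz y : W y -> \det (T y) != 0 by move=> [_ /Tneq0].
  apply: eq_is_section (is_section_div hsum hdetW nz) => [k|y].
    by rewrite /diag_twist subrr.
  by rewrite !mxE mulrC.
have : is_section (diag_twist 0) W
    (fun y => \sum_i (colsub g 1%:M : 'M[K]_(q, p)) j i * r y i 0).
  by apply: is_section_sum => // i; apply: is_sectionZ.
by apply: eq_is_section => // y; rewrite mxE.
Qed.

(** [A x] may drop rank where [y] vanishes: a section killed by [A] is killed by [y], and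
    irreducibility of X makes it zero. *)
Lemma linear_monad_of_row_free al be ga
    (A : hcoord -> 'M[K]_(be, al)) (B : hcoord -> 'M[K]_(ga, be))
    (y : hcoord -> K) (o : hcoord) :
  linear_mx A -> linear_mx B -> (forall x, B x *m A x = 0) ->
  (forall x, row_free (B x)) ->
  is_section (diag_twist 1) [set: hcoord] y -> y o != 0 ->
  (forall x (s : 'cV_al), A x *m s = 0 -> y x *: s = 0) ->
  linear_monad A B.
Proof.
move=> hA hB BA Bfree hy yo Ainj; split=> //.
- by move=> U s _ _ x _; rewrite mulmxA BA mul0mx.
- move=> U s oU hs As x Ux; apply/colP => j; rewrite [RHS]mxE.
  apply: (is_section_mul_eq0 oU (hs j) hy yo) Ux => z Uz.
  by have /colP/(_ j) := Ainj z _ (As z Uz); rewrite !mxE.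
exact: linear_mx_surjective.
Qed.

(** O(1, ..., 1) has no base point: choosing a nonzero coordinate of [x] in each factor, their
    product [Q] is a section that is nonzero at [x]. *)
Lemma h0_basis_neq0 m (e : hcoord -> 'cV[K]_m) :
  (forall s, is_section (diag_twist 1) [set: hcoord] s ->
     exists c : 'rV[K]_m, forall x, s x = (c *m e x) 0 0) ->
  forall x, e x != 0.
Proof.
move=> spans x.
have /fin_all_exists[j xj] : forall i, exists j, x i 0 j != 0.
  by move=> i; apply/rV0Pn; apply: hcoord_neq0.
pose v i : 'I_#|hvar a| := enum_rank (Tagged (fun i => 'I_(a i).+1) (j i)).
pose Q : hpoly K a := 'X_[[multinom (k == v (tag (enum_val k)) : nat) | k < #|hvar a|]].
have hQ : multihomog (fun=> 1%N) Q.
  move=> u; rewrite msuppX inE => /eqP -> i.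
  rewrite (bigD1 (v i)) /= ?enum_rankK // mnmE enum_rankK eqxx.
  by rewrite big1 ?addn0 // => k /andP[/eqP ki /negPf ne]; rewrite mnmE ki ne.
have Qx : heval Q x != 0.
  rewrite /heval mevalX; apply/prodf_neq0 => k _; rewrite mnmE.
  have [kv|_] := eqVneq k (v (tag (enum_val k))); last by rewrite expr0 oner_neq0.
  by rewrite expr1 kv /v enum_rankK.
have [|c cE] := spans (heval Q).
  move=> z _; exists [set: hcoord]; split=> //; first exact: zopenT.
  exists Q, 1, (fun=> 1%N), (fun=> 0%N); split=> //; first exact: multihomogC.
  by move=> w _; rewrite heval1 divr1 oner_neq0.
by apply: contraNneq Qx => ex; rewrite cE ex mulmx0 mxE.
Qed.

Lemma linear_mx_toeplitz m p q (v : hcoord -> 'cV[K]_m) :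
  is_vsection (diag_twist 1) [set: hcoord] v ->
  linear_mx (fun x => toeplitz p q (v x)).
Proof.
move=> hv i j; have h0 := is_section0 (diag_twist 1) (@zopenT K n a).
have [ij|ji] := leqP i j; last first.
  by apply: eq_is_section h0 => // x; rewrite mxE leqNgt ji.
case Ek: (insub (j - i)%N : option 'I_m) => [k|].
  by apply: eq_is_section (hv k) => // x; rewrite mxE ij Ek.
by apply: eq_is_section h0 => // x; rewrite mxE ij Ek.
Qed.

Lemma linear_mxZ p q (y : hcoord -> K) (C : 'M[K]_(p, q)) :
  is_section (diag_twist 1) [set: hcoord] y -> linear_mx (fun x => y x *: C).
Proof.
move=> hy i j.
apply: eq_is_section (is_sectionZ (C i j) (@zopenT K n a) hy) => // x.
by rewrite mxE mulrC.
Qed.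

Lemma linear_mx0 p q : linear_mx (fun _ : hcoord => 0 : 'M[K]_(p, q)).
Proof.
move=> i j; apply: eq_is_section (is_section0 _ (@zopenT K n a)) => // x.
by rewrite mxE.
Qed.

Lemma linear_mxN p q (M : hcoord -> 'M[K]_(p, q)) :
  linear_mx M -> linear_mx (fun x => - M x).
Proof.
move=> hM i j.
apply: eq_is_section (is_sectionZ (-1) (@zopenT K n a) (hM i j)) => // x.
by rewrite mxE mulN1r.
Qed.

Lemma linear_mx_row p q1 q2 (M1 : hcoord -> 'M[K]_(p, q1)) (M2 : hcoord -> 'M_(p, q2)) :
  linear_mx M1 -> linear_mx M2 -> linear_mx (fun x => row_mx (M1 x) (M2 x)).
Proof.
move=> h1 h2 i j; case: (split_ordP j) => k ->.
  by apply: eq_is_section (h1 i k) => // x; rewrite row_mxEl.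
by apply: eq_is_section (h2 i k) => // x; rewrite row_mxEr.
Qed.

Lemma linear_mx_col p1 p2 q (M1 : hcoord -> 'M[K]_(p1, q)) (M2 : hcoord -> 'M_(p2, q)) :
  linear_mx M1 -> linear_mx M2 -> linear_mx (fun x => col_mx (M1 x) (M2 x)).
Proof.
move=> h1 h2 i j; case: (split_ordP i) => k ->.
  by apply: eq_is_section (h1 k j) => // x; rewrite col_mxEu.
by apply: eq_is_section (h2 k j) => // x; rewrite col_mxEd.
Qed.

(** * The two monads *)

Section Construction.
Variables (N : nat) (e : hcoord -> 'cV[K]_N.+1).
Hypothesis he : is_vsection (diag_twist 1) [set: hcoord] e.
Hypothesis e_neq0 : forall x, e x != 0.

Lemma exists_coord_neq0 : exists (o : hcoord) k, e o k 0 != 0.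
Proof.
pose o i : 'rV[K]_(a i).+1 := const_mx 1.
have o0 i : o i != 0 by apply/rV0Pn; exists 0; rewrite mxE oner_neq0.
by have /cV0Pn[k] := e_neq0 (HCoord o0); exists (HCoord o0), k.
Qed.

(** Here [b] stands for beta - gamma. Dropping one coordinate leaves [N] entries, hence the bound
    [ga + N <= b.+1]. *)
Lemma exists_monad_koszul al b ga : (al <= b)%N -> (ga + N <= b.+1)%N ->
  exists (A : hcoord -> 'M[K]_(b + ga, al)) (B : hcoord -> 'M[K]_(ga, b + ga)),
    linear_monad A B.
Proof.
move=> alb gab; have [o [k yo]] := exists_coord_neq0.
pose y x := e x k 0; pose X x := toeplitz ga b (row' k (e x)).
(* Multiplying on the right by [J] keeps the first [al] of the [b] syzygies. *)
pose w := widen_ord alb; pose J : 'M[K]_(b, al) := colsub w 1%:M.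
have hX : linear_mx X.
  apply: linear_mx_toeplitz => j.
  by apply: eq_is_section (he (lift k j)) => // x; rewrite mxE.
have hXw : linear_mx (fun x => colsub w (X x)).
  by move=> i j; apply: eq_is_section (hX i (w j)) => // x; rewrite [RHS]mxE.
exists (fun x => col_mx (y x *: J) (- colsub w (X x))).
exists (fun x => row_mx (X x) (y x *: 1%:M)).
apply: (linear_monad_of_row_free (y := y) (o := o)) => //.
- by apply: linear_mx_col; [apply: linear_mxZ; apply: he | apply: linear_mxN].
- by apply: linear_mx_row => //; apply: linear_mxZ; apply: he.
- move=> x; rewrite mul_row_col -scalemxAr mulmx_colsub mulmx1.
  by rewrite -scalemxAl mul1mx scalerN subrr.
- move=> x; have [y0|y0] := eqVneq (y x) 0.
    apply/row_free_row_mxl/toeplitz_row_free; last by rewrite addnC.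
    apply: contraNneq (e_neq0 x) => r0; apply/eqP/colP => i; rewrite [RHS]mxE.
    case: (unliftP k i) => [j ->|->]; last exact: y0.
    by have /colP/(_ j) := r0; rewrite !mxE.
  apply: row_free_row_mxr; rewrite row_free_unit unitmxE detZ det1 mulr1.
  by rewrite unitfE expf_neq0.
- exact: he.
move=> x s; rewrite mul_col_mx => /eqP; rewrite col_mx_eq0 => /andP[/eqP Js _].
(* The first [al] rows of [J] form the identity, so they turn [y J s = 0] into [y s = 0]. *)
have /(congr1 (rowsub w)) := Js; rewrite -scalemxAl.
move/colP => h; apply/colP => i; have := h i; rewrite !mxE => <-; congr (_ * _).
rewrite (bigD1 i) //= big1 => [|l li]; first by rewrite !mxE eqxx mul1r addr0.
by rewrite !mxE -val_eqE /= val_eqE eq_sym (negPf li) mul0r.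
Qed.

(** Here [b] stands for beta - alpha. All [N.+1] coordinates enter the Toeplitz block, so it needs
    one more column than in the other construction. *)
Lemma exists_monad_split al b ga : (ga + N <= b)%N ->
  exists (A : hcoord -> 'M[K]_(b + al, al)) (B : hcoord -> 'M[K]_(ga, b + al)),
    linear_monad A B.
Proof.
move=> gab; have [o [k yo]] := exists_coord_neq0; pose y x := e x k 0.
exists (fun x => col_mx 0 (y x *: 1%:M)).
exists (fun x => row_mx (toeplitz ga b (e x)) 0).
apply: (linear_monad_of_row_free (y := y) (o := o)) => //.
- by apply: linear_mx_col; [apply: linear_mx0 | apply: linear_mxZ; apply: he].
- by apply: linear_mx_row; [apply: linear_mx_toeplitz | apply: linear_mx0].
- by move=> x; rewrite mul_row_col mulmx0 mul0mx addr0.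
- by move=> x; apply/row_free_row_mxl/toeplitz_row_free; rewrite // addSn ltnS addnC.
- exact: he.
move=> x s; rewrite mul_col_mx => /eqP; rewrite col_mx_eq0 => /andP[_ /eqP].
by rewrite -scalemxAl mul1mx.
Qed.

End Construction.
End LinearMonads.

End MonadConstruction.

Theorem theorem4p1 (R : realType) (n : nat) (a : 'I_n -> nat)
    (alpha beta gamma N : nat)
    (n_gt0 : (0 < n)%N)
    (a_gt0 : forall i, (0 < a i)%N)
    (a_le : forall i j : 'I_n, (i <= j)%N -> (a i <= a j)%N)
    (a_parity :
      (forall i j : 'I_n, j = i.+1 :> nat -> odd (a j) = ~~ odd (a i)) \/
      (exists i : 'I_n, odd (a i)))
    (hN : @h0_eq R[i] n a (diag_twist 1) N.+1)
    (alpha_gt0 : (0 < alpha)%N)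
    (beta_gt0 : (0 < beta)%N)
    (gamma_gt0 : (0 < gamma)%N)
    (hab : ((2 * gamma + N - 1 <= beta)%N /\ (alpha + gamma <= beta)%N) \/
           (alpha + gamma + N <= beta)%N) :
  exists (A : hcoord R[i] a -> 'M[R[i]]_(beta, alpha))
         (B : hcoord R[i] a -> 'M[R[i]]_(gamma, beta)),
    linear_monad A B.
Proof.
have [e [he span]] := hN.
have e0 : forall x, e x != 0%R.
  by apply: h0_basis_neq0 => s /span[c [cE _]]; exists c.
case: hab => [[h1 h2]|h].
  (* With [b = beta - gamma], the two bounds of (a) become [gamma + N <= b + 1] and [alpha <= b]; as
     [gamma > 0], the subtraction of 1 does not truncate. *)
  have hb : (gamma <= beta)%N by lia.
  by rewrite -(subnK hb); apply: (exists_monad_koszul he e0); lia.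
have hb : (alpha <= beta)%N by lia.
by rewrite -(subnK hb); apply: (exists_monad_split he e0); lia.
Qed.
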